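(* Let $r$ be a term and $A$ a type with $r:A$. If $r\to s$ or $r\rightleftarrows s$, then $s:A$.
   Context: Types are generated by $A ::= \tau \mid A\Rightarrow A \mid A\wedge A$, where $\tau$ is the only atomic type ($\Rightarrow$ associates to the right). Type equivalence $\equiv$ is the smallest congruence on types such that $A\wedge B\equiv B\wedge A$, $A\wedge(B\wedge C)\equiv(A\wedge B)\wedge C$, $A\Rightarrow(B\wedge C)\equiv(A\Rightarrow B)\wedge(A\Rightarrow C)$ and $(A\wedge B)\Rightarrow C\equiv A\Rightarrow B\Rightarrow C$. To each type $A$ is associated an infinite set of variables $\mathcal V_A$, with $\mathcal V_A=\mathcal V_B$ if $A\equiv B$ and $\mathcal V_A\cap\mathcal V_B=\emptyset$ otherwise. Preterms are $r ::= x \mid \lambda x.r \mid rr \mid r\times r \mid \pi_A(r)$ (variables, abstractions, applications, products, projections; application is left associative); one writes $\lambda x^A.r$ for $\lambda x.r$ when $x\in\mathcal V_A$. Introductions are abstractions and products; eliminations are applications and projections. Free variables, $\alpha$-equivalence and substitution $r[s/x]$ are as usual. The typing judgement $r:A$ (without contexts) is given by: $x:A$ if $x\in\mathcal V_A$; if $r:A$ and $A\equiv B$ then $r:B$; if $r:B$ then $\lambda x^A.r:A\Rightarrow B$; if $r:A\Rightarrow B$ and $s:A$ then $rs:B$; if $r:A$ and $s:B$ then $r\times s:A\wedge B$; if $r:A\wedge B$ then $\pi_A(r):A$. Terms are well-typed preterms. The relation $\rightleftarrows$ is the smallest symmetric relation, closed under all term contexts, containing: $r\times s\rightleftarrows s\times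 r$; $(r\times s)\times t\rightleftarrows r\times(s\times t)$; $\lambda x^A.(r\times s)\rightleftarrows \lambda x^A.r\times\lambda x^A.s$; $rst\rightleftarrows r(s\times t)$. Reduction: define $\to_{\beta\pi\zeta}$ by: if $s:A$ then $(\lambda x^A.r)s\to_{\beta\pi\zeta} r[s/x]$; if $r:A$ then $\pi_A(r\times s)\to_{\beta\pi\zeta} r$; $(r\times s)t\to_{\beta\pi\zeta} rt\times st$. Define $\to_{\eta\delta}$ by: if $r:A\Rightarrow B$, $r$ is an elimination or a variable, and $x\in\mathcal V_A$ is fresh, then $r\to_{\eta\delta}\lambda x^A.(rx)$; if $r:A\wedge B$ and $r$ is an elimination or a variable, then $r\to_{\eta\delta}\pi_A(r)\times\pi_B(r)$. The relations $\hookrightarrow$ and $\to$ are defined simultaneously as the smallest relations such that: $r\to_{\beta\pi\zeta}s$ implies $r\hookrightarrow s$; $r\to_{\eta\delta}s$ implies $r\to s$; $r\hookrightarrow s$ implies $r\to s$; $r\to s$ implies $\lambda x.r\hookrightarrow\lambda x.s$; $r\hookrightarrow s$ implies $rt\hookrightarrow st$; $r\to s$ implies $tr\hookrightarrow ts$, $r\times t\hookrightarrow s\times t$ and $t\times r\hookrightarrow t\times s$; $r\hookrightarrow s$ implies $\pi_A(r)\hookrightarrow\pi_A(s)$. *)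

(* Defs.v *)
From Stdlib Require Import List Arith Lia.
Import ListNotations.

Inductive type : Type :=
| Tau : type
| Arr : type -> type -> type
| Conj : type -> type -> type.

Definition type_eq_dec (A B : type) : {A = B} + {A <> B}.
Proof. decide equality. Defined.

Inductive tequiv : type -> type -> Prop :=
| tequiv_refl A : tequiv A A
| tequiv_sym A B : tequiv A B -> tequiv B A
| tequiv_trans A B C : tequiv A B -> tequiv B C -> tequiv A C
| tequiv_arr A A' B B' :
    tequiv A A' -> tequiv B B' -> tequiv (Arr A B) (Arr A' B')
| tequiv_conj A A' B B' :
    tequiv A A' -> tequiv B B' -> tequiv (Conj A B) (Conj A' B')
| tequiv_comm A B : tequiv (Conj A B) (Conj B A)
| tequiv_assoc A B C : tequiv (Conj A (Conj B C)) (Conj (Conj A B) C)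
| tequiv_dist A B C : tequiv (Arr A (Conj B C)) (Conj (Arr A B) (Arr A C))
| tequiv_curry A B C : tequiv (Arr (Conj A B) C) (Arr A (Arr B C)).

(* A variable is a name paired with a representative of the equivalence class
   of its type; the lemmas [inV_*] check the requirements on the sets V_A. *)
Definition var : Type := (type * nat)%type.

Definition var_eq_dec (x y : var) : {x = y} + {x <> y}.
Proof. decide equality; [apply Nat.eq_dec | apply type_eq_dec]. Defined.

Definition inV (A : type) (x : var) : Prop := tequiv A (fst x).

Lemma inV_equiv A B : tequiv A B -> forall x, inV A x <-> inV B x.
Proof.
  unfold inV; intros E x; split; intros H.
  - exact (tequiv_trans _ _ _ (tequiv_sym _ _ E) H).
  - exact (tequiv_trans _ _ _ E H).
Qed.

Lemma inV_disjoint A B : ~ tequiv A B -> forall x, ~ (inV A x /\ inV B x).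
Proof.
  unfold inV; intros N x [H1 H2].
  exact (N (tequiv_trans _ _ _ H1 (tequiv_sym _ _ H2))).
Qed.

Inductive preterm : Type :=
| Var : var -> preterm
| Lam : var -> preterm -> preterm
| App : preterm -> preterm -> preterm
| Prod : preterm -> preterm -> preterm
| Proj : type -> preterm -> preterm.

Fixpoint fv (r : preterm) : list var :=
  match r with
  | Var x => [x]
  | Lam x r => remove var_eq_dec x (fv r)
  | App r s | Prod r s => fv r ++ fv s
  | Proj _ r => fv r
  end.

(* [x] itself if it is not in [l], otherwise a variable of the same type
   that is not in [l]. *)
Definition refresh (x : var) (l : list var) : var :=
  if in_dec var_eq_dec x l then (fst x, S (list_max (map snd l))) else x.

Lemma refresh_notin x l : ~ In (refresh x l) l.
Proof.
  unfold refresh; destruct (in_dec var_eq_dec x l) as [_ | H]; [| exact H].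
  intros H; apply (in_map snd) in H; simpl in H.
  pose proof (proj1 (list_max_le (map snd l) _) (le_n _)) as M.
  rewrite Forall_forall in M; specialize (M _ H); lia.
Qed.

Lemma inV_infinite A (l : list var) : exists x, inV A x /\ ~ In x l.
Proof.
  exists (refresh (A, 0) l); split; [| apply refresh_notin].
  unfold inV, refresh; destruct in_dec; apply tequiv_refl.
Qed.

Definition update (sigma : var -> preterm) (x : var) (s : preterm)
  : var -> preterm :=
  fun y => if var_eq_dec y x then s else sigma y.

(* Capture-avoiding substitution.  It is simultaneous so that renaming a bound
   variable and substituting below it is a single structural recursion. *)
Fixpoint msubst (sigma : var -> preterm) (r : preterm) : preterm :=
  match r with
  | Var x => sigma x
  | Lam x r0 =>
      let z := refresh x (flat_map (fun y => fv (sigma y))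
                            (remove var_eq_dec x (fv r0))) in
      Lam z (msubst (update sigma x (Var z)) r0)
  | App r1 r2 => App (msubst sigma r1) (msubst sigma r2)
  | Prod r1 r2 => Prod (msubst sigma r1) (msubst sigma r2)
  | Proj A r0 => Proj A (msubst sigma r0)
  end.

(* [subst s x r] is r[s/x]. *)
Definition subst (s : preterm) (x : var) (r : preterm) : preterm :=
  msubst (update Var x s) r.

(* A bound variable may only be renamed to a variable of the same type. *)
Inductive alpha : preterm -> preterm -> Prop :=
| alpha_refl r : alpha r r
| alpha_sym r s : alpha r s -> alpha s r
| alpha_trans r s t : alpha r s -> alpha s t -> alpha r t
| alpha_lam x r s : alpha r s -> alpha (Lam x r) (Lam x s)
| alpha_app r r' s s' : alpha r r' -> alpha s s' -> alpha (App r s) (App r' s')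
| alpha_prod r r' s s' :
    alpha r r' -> alpha s s' -> alpha (Prod r s) (Prod r' s')
| alpha_proj A r s : alpha r s -> alpha (Proj A r) (Proj A s)
| alpha_rename A x y r :
    inV A x -> inV A y -> ~ In y (fv r) ->
    alpha (Lam x r) (Lam y (subst (Var y) x r)).

Inductive has_type : preterm -> type -> Prop :=
| ht_var x A : inV A x -> has_type (Var x) A
| ht_equiv r A B : has_type r A -> tequiv A B -> has_type r B
| ht_lam x r A B : inV A x -> has_type r B -> has_type (Lam x r) (Arr A B)
| ht_app r s A B :
    has_type r (Arr A B) -> has_type s A -> has_type (App r s) B
| ht_prod r s A B :
    has_type r A -> has_type s B -> has_type (Prod r s) (Conj A B)
| ht_proj r A B : has_type r (Conj A B) -> has_type (Proj A r) A.

(* Preterms are considered up to alpha-equivalence; the relations below are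
   therefore generated together with closure under [alpha] on both sides. *)
Inductive teq : preterm -> preterm -> Prop :=
| teq_comm r s : teq (Prod r s) (Prod s r)
| teq_assoc r s t : teq (Prod (Prod r s) t) (Prod r (Prod s t))
| teq_dist x r s : teq (Lam x (Prod r s)) (Prod (Lam x r) (Lam x s))
| teq_curry r s t : teq (App (App r s) t) (App r (Prod s t))
| teq_sym r s : teq r s -> teq s r
| teq_lam x r s : teq r s -> teq (Lam x r) (Lam x s)
| teq_appl r s t : teq r s -> teq (App r t) (App s t)
| teq_appr r s t : teq r s -> teq (App t r) (App t s)
| teq_prodl r s t : teq r s -> teq (Prod r t) (Prod s t)
| teq_prodr r s t : teq r s -> teq (Prod t r) (Prod t s)
| teq_proj A r s : teq r s -> teq (Proj A r) (Proj A s)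
| teq_alpha r r' s s' : alpha r r' -> teq r' s' -> alpha s' s -> teq r s.

Inductive red_bpz : preterm -> preterm -> Prop :=
| bpz_beta A x r s :
    inV A x -> has_type s A -> red_bpz (App (Lam x r) s) (subst s x r)
| bpz_pi A r s : has_type r A -> red_bpz (Proj A (Prod r s)) r
| bpz_zeta r s t :
    red_bpz (App (Prod r s) t) (Prod (App r t) (App s t)).

Definition elim_or_var (r : preterm) : Prop :=
  match r with
  | Var _ | App _ _ | Proj _ _ => True
  | Lam _ _ | Prod _ _ => False
  end.

Inductive red_ed : preterm -> preterm -> Prop :=
| ed_eta A B x r :
    has_type r (Arr A B) -> elim_or_var r -> inV A x -> ~ In x (fv r) ->
    red_ed r (Lam x (App r (Var x)))
| ed_delta A B r :
    has_type r (Conj A B) -> elim_or_var r ->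
    red_ed r (Prod (Proj A r) (Proj B r)).

(* [hred] is the hooked arrow, [red] the plain one. *)
Inductive hred : preterm -> preterm -> Prop :=
| hred_bpz r s : red_bpz r s -> hred r s
| hred_lam x r s : red r s -> hred (Lam x r) (Lam x s)
| hred_appl r s t : hred r s -> hred (App r t) (App s t)
| hred_appr r s t : red r s -> hred (App t r) (App t s)
| hred_prodl r s t : red r s -> hred (Prod r t) (Prod s t)
| hred_prodr r s t : red r s -> hred (Prod t r) (Prod t s)
| hred_proj A r s : hred r s -> hred (Proj A r) (Proj A s)
| hred_alpha r r' s s' : alpha r r' -> hred r' s' -> alpha s' s -> hred r s
with red : preterm -> preterm -> Prop :=
| red_of_ed r s : red_ed r s -> red r s
| red_of_hred r s : hred r s -> red r s
| red_alpha r r' s s' : alpha r r' -> red r' s' -> alpha s' s -> red r s.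

(* Main.v *)
From mathcomp Require Import all_boot.
Require Import Defs.

Set Implicit Arguments.
Unset Strict Implicit.

(** Modulo [tequiv] a type is a non-empty multiset of prime types, a prime type
    being a multiset of prime arguments with result [Tau].  Sorting multisets
    gives a sound and complete normal form, hence the two facts about [tequiv]
    that typing needs: an arrow determines its codomain once its domain is known,
    and a conjunction equivalent to [Arr A C] splits [C] accordingly.  The first
    makes types unique up to [tequiv], so typing is invariant under well-typed
    substitution in both directions, which takes care of alpha-conversion and
    beta; the second is what the zeta rule needs. *)

(** * Normal forms of types *)

(* A prime type is represented by the node carrying its arguments; a leaf is
   junk, read as a prime without arguments. *)
Definition prime_tree : Type := GenTree.tree unit.

Definition args (p : prime_tree) : seq prime_tree :=
  if p is GenTree.Node _ l then l else [::].

(** Pulling [leq] back along the injective [pickle] gives a total antisymmetric order, so sorting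
    picks one representative of each multiset. *)
Definition tree_le : rel prime_tree := relpre pickle leq.

Definition add_args (l : seq prime_tree) (p : prime_tree) : prime_tree :=
  GenTree.Node 0 (sort tree_le (args p ++ l)).

(** Distributivity attaches the domain to every prime of the codomain; currying turns the primes of
    the domain into separate arguments. The outer list stays unsorted and is compared up to
    [perm_eq]. *)
Fixpoint nf (A : type) : seq prime_tree :=
  match A with
  | Tau => [:: GenTree.Node 0 [::]]
  | Arr A B => map (add_args (nf A)) (nf B)
  | Conj A B => nf A ++ nf B
  end.

Lemma sort_tree_leP (l l' : seq prime_tree) :
  reflect (sort tree_le l = sort tree_le l') (perm_eq l l').
Proof.
apply: perm_sortP => [x y|y x z|x y].
- exact: leq_total.
- exact: leq_trans.
- by move=> H; apply: (pcan_inj (@pickleK _)); apply: anti_leq.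
Qed.

Lemma add_args_perm l l' : perm_eq l l' -> add_args l =1 add_args l'.
Proof.
by move=> H p; congr GenTree.Node; apply/sort_tree_leP; rewrite perm_cat2l.
Qed.

Lemma add_args_inj l p q :
  add_args l p = add_args l q -> perm_eq (args p) (args q).
Proof. by case=> /sort_tree_leP; rewrite perm_cat2r. Qed.

(** The counterpart of [tequiv_curry] on primes. *)
Lemma add_argsD l l' p : add_args (l ++ l') p = add_args l (add_args l' p).
Proof.
congr GenTree.Node; apply/sort_tree_leP.
by rewrite perm_catCA perm_sym perm_catC perm_cat2l perm_sort.
Qed.

Lemma nf_sound A B : tequiv A B -> perm_eq (nf A) (nf B).
Proof.
elim=> {A B} //=.
- by move=> A B _; rewrite perm_sym.
- by move=> A B C _ H1 _; apply: perm_trans.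
- move=> A A' B B' _ HA _ HB.
  by rewrite (eq_map (add_args_perm HA)) perm_map.
- by move=> A A' B B' _ HA _ HB; apply: perm_cat.
- by move=> A B; rewrite perm_catC.
- by move=> A B C; rewrite catA.
- by move=> A B C; rewrite map_cat.
- move=> A B C; rewrite -map_comp.
  by rewrite (eq_map (add_argsD (nf A) (nf B))).
Qed.

(** Keeps the junk value of [conjs] at the empty list out of the way. *)
Lemma nf_neq0 A : nf A != [::].
Proof.
elim: A => //= A HA B HB; first by case: (nf B) HB.
by case: (nf A) HA.
Qed.

(** * Reading normal forms back as types *)

Fixpoint prime_type (p : prime_tree) : type :=
  match p with
  | GenTree.Node _ l => foldr (fun q => Arr (prime_type q)) Tau l
  | _ => Tau
  end.

Definition arrows (l : seq prime_tree) (C : type) : type :=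
  foldr (fun q => Arr (prime_type q)) C l.

(* The empty conjunction, which does not exist as a type, is sent to [Tau]. *)
Fixpoint conjs (l : seq prime_tree) : type :=
  match l with
  | [::] => Tau
  | [:: p] => prime_type p
  | p :: l => Conj (prime_type p) (conjs l)
  end.

Lemma conjs_cons p l : l != [::] -> conjs (p :: l) = Conj (prime_type p) (conjs l).
Proof. by case: l. Qed.

Lemma prime_typeE p : prime_type p = arrows (args p) Tau.
Proof. by case: p. Qed.

Lemma arrows_cat l l' C : arrows (l ++ l') C = arrows l (arrows l' C).
Proof. by rewrite /arrows foldr_cat. Qed.

Lemma tequiv_arrows l C C' : tequiv C C' -> tequiv (arrows l C) (arrows l C').
Proof. by move=> H; elim: l => //= p l; apply/tequiv_arr/tequiv_refl. Qed.

(** Both sides are curried forms of an arrow from a commutative conjunction. *)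
Lemma tequiv_swap A B C : tequiv (Arr A (Arr B C)) (Arr B (Arr A C)).
Proof.
apply: tequiv_trans (tequiv_sym _ _ (tequiv_curry _ _ _)) _.
apply: tequiv_trans (tequiv_curry _ _ _).
by apply: tequiv_arr; [apply: tequiv_comm | apply: tequiv_refl].
Qed.

Lemma arrows_swap l l' C :
  tequiv (arrows l (arrows l' C)) (arrows l' (arrows l C)).
Proof.
elim: l => /= [|p l IH]; first exact: tequiv_refl.
apply: tequiv_trans (tequiv_arr _ _ _ _ (tequiv_refl _) IH) _.
elim: l' {IH} => /= [|q l' IH]; first exact: tequiv_refl.
apply: tequiv_trans (tequiv_swap _ _ _) _.
by apply: tequiv_arr IH; apply: tequiv_refl.
Qed.

Lemma arrows_perm l l' C : perm_eq l l' -> tequiv (arrows l C) (arrows l' C).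
Proof.
move=> H; pose P s := tequiv (arrows l C) (arrows s C).
(* Every permutation reduces to exchanging the two leading blocks of a list. *)
suff: P l' by []; apply: catCA_perm_ind H _; last exact: tequiv_refl.
move=> s1 s2 s3 /tequiv_trans; apply; rewrite !arrows_cat.
exact: arrows_swap.
Qed.

Lemma conjs_cat l l' : l != [::] -> l' != [::] ->
  tequiv (conjs (l ++ l')) (Conj (conjs l) (conjs l')).
Proof.
move=> + nz'; elim: l => // p [|q l] IH _.
  by rewrite cat1s conjs_cons //; exact: tequiv_refl.
rewrite cat_cons !(conjs_cons p) //.
apply: tequiv_trans (tequiv_assoc _ _ _).
by apply: tequiv_conj (IH isT); apply: tequiv_refl.
Qed.

Lemma conjs_perm l l' : perm_eq l l' -> tequiv (conjs l) (conjs l').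
Proof.
have catC s1 s2 : tequiv (conjs (s1 ++ s2)) (conjs (s2 ++ s1)).
  case: (eqVneq s1 [::]) => [->|nz1]; first by rewrite cats0; exact: tequiv_refl.
  case: (eqVneq s2 [::]) => [->|nz2]; first by rewrite cats0; exact: tequiv_refl.
  apply: tequiv_trans (conjs_cat nz1 nz2) _.
  apply: tequiv_trans (tequiv_comm _ _) _.
  exact/tequiv_sym/conjs_cat.
move=> H; pose P s := tequiv (conjs l) (conjs s).
suff: P l' by []; apply: catCA_perm_ind H _; last exact: tequiv_refl.
move=> s1 s2 s3 /tequiv_trans; apply; rewrite !catA.
(* Empty blocks are treated apart, since [conjs_cat] needs both pieces non-empty. *)
case: (eqVneq s3 [::]) => [->|nz3]; first by rewrite !cats0.
case: (eqVneq (s1 ++ s2) [::]) => [|nz].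
  by case: s1 => //= ->; exact: tequiv_refl.
have nz' : s2 ++ s1 != [::] by rewrite -size_eq0 size_cat addnC -size_cat size_eq0.
apply: tequiv_trans (conjs_cat nz nz3) _.
apply: tequiv_trans (tequiv_sym _ _ (conjs_cat nz' nz3)).
by apply: tequiv_conj; [apply: catC | apply: tequiv_refl].
Qed.

Lemma tequiv_arr_conjs l C : l != [::] -> tequiv (Arr (conjs l) C) (arrows l C).
Proof.
elim: l => // p [|q l] IH _; first exact: tequiv_refl.
rewrite (conjs_cons p) //; apply: tequiv_trans (tequiv_curry _ _ _) _.
by apply: tequiv_arr (IH isT); apply: tequiv_refl.
Qed.

Lemma prime_type_add_args l p : l != [::] ->
  tequiv (prime_type (add_args l p)) (Arr (conjs l) (prime_type p)).
Proof.
move=> nz; apply: tequiv_trans (tequiv_sym _ _ (tequiv_arr_conjs _ nz)).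
rewrite !prime_typeE -arrows_cat; apply: arrows_perm.
by rewrite /= perm_sort perm_catC.
Qed.

Lemma conjs_add_args l m : l != [::] -> m != [::] ->
  tequiv (conjs (map (add_args l) m)) (Arr (conjs l) (conjs m)).
Proof.
move=> nz; elim: m => // p [|q m] IH _; first exact: prime_type_add_args.
rewrite map_cons (conjs_cons p) // (conjs_cons (add_args l p)) //.
apply: tequiv_trans (tequiv_sym _ _ (tequiv_dist _ _ _)).
by apply: tequiv_conj (IH isT); apply: prime_type_add_args.
Qed.

(** With [conjs_perm] this gives completeness: types whose normal forms are permutations of each
    other are equivalent. *)
Lemma conjs_nf A : tequiv (conjs (nf A)) A.
Proof.
elim: A => /= [|A HA B HB|A HA B HB]; first exact: tequiv_refl.
- apply: tequiv_trans (conjs_add_args (nf_neq0 A) (nf_neq0 B)) _.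
  exact: tequiv_arr.
- apply: tequiv_trans (conjs_cat (nf_neq0 A) (nf_neq0 B)) _.
  exact: tequiv_conj.
Qed.

(** * Cancelling and splitting arrows *)

(** A permutation is a list of indices, and the same indices rearrange [t]; this works even when [f]
    identifies elements. *)
Lemma perm_map_lift (T U : eqType) (f : T -> U) (s : seq U) (t : seq T) :
  perm_eq s (map f t) -> exists2 t', perm_eq t' t & s = map f t'.
Proof.
(* A non-empty [t] supplies the default element for [nth]. *)
case: t => [|x t]; first by move=> /perm_nilP ->; exists [::].
move=> /(perm_iotaP (f x)); rewrite size_map => -[I HI ->].
exists (map (nth x (x :: t)) I); first by apply/(perm_iotaP x); exists I.
rewrite -map_comp; apply/eq_in_map => i.
by rewrite (perm_mem HI) mem_iota => /andP[_ lti] /=; rewrite -(nth_map x (f x)).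
Qed.

Lemma conjs_map_add_args_inj l m m' :
  map (add_args l) m = map (add_args l) m' -> tequiv (conjs m) (conjs m').
Proof.
have E p q : add_args l p = add_args l q -> tequiv (prime_type p) (prime_type q).
  by move=> /add_args_inj; rewrite !prime_typeE; apply: arrows_perm.
elim: m m' => [|p m IH] [|p' m'] //; first by move=> _; exact: tequiv_refl.
move=> [Hp] => Hm; have /E Ep : add_args l p = add_args l p' by congr GenTree.Node.
move: m m' IH Hm => [|q m] [|q' m'] IH Hm //.
rewrite (conjs_cons p) // (conjs_cons p') //.
by apply: tequiv_conj Ep _; apply: IH.
Qed.

(** Equivalent domains make both normal forms images under the same [add_args], which cancels. By
    [tequiv_swap], an arrow alone does not determine its codomain. *)
Lemma tequiv_arr_inj A A' B B' :
  tequiv A A' -> tequiv (Arr A B) (Arr A' B') -> tequiv B B'.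
Proof.
move=> EA /nf_sound /=; rewrite (eq_map (add_args_perm (nf_sound EA))).
move=> /perm_map_lift [m Hm /conjs_map_add_args_inj E].
apply: tequiv_trans (tequiv_sym _ _ (conjs_nf B)) _.
apply: tequiv_trans E _.
by apply: tequiv_trans (conjs_nf B'); apply: conjs_perm.
Qed.

(** Every prime of [B1] and [B2] arises by adding the arguments [nf A] to a prime of [C]. Cutting
    the lifted list [m] after the primes of [B1] yields [C1] and [C2]. *)
Lemma tequiv_conj_arr B1 B2 A C : tequiv (Conj B1 B2) (Arr A C) ->
  exists C1 C2, [/\ tequiv B1 (Arr A C1), tequiv B2 (Arr A C2)
                  & tequiv (Conj C1 C2) C].
Proof.
move=> /nf_sound /= /perm_map_lift [m Hm E].
have split B m' : nf B = map (add_args (nf A)) m' ->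
    m' != [::] /\ tequiv B (Arr A (conjs m')).
  move=> Em; have nz : m' != [::].
    by have := nf_neq0 B; rewrite Em; case: (m').
  split=> //; apply: tequiv_trans (tequiv_sym _ _ (conjs_nf B)) _.
  rewrite Em; apply: tequiv_trans (conjs_add_args (nf_neq0 A) nz) _.
  by apply: tequiv_arr; [apply: conjs_nf | apply: tequiv_refl].
pose n := size (nf B1).
have [|nz1 E1] := split B1 (take n m).
  by rewrite map_take -E take_size_cat.
have [|nz2 E2] := split B2 (drop n m).
  by rewrite map_drop -E drop_size_cat.
exists (conjs (take n m)), (conjs (drop n m)); split=> //.
apply: tequiv_trans (tequiv_sym _ _ (conjs_cat nz1 nz2)) _.
rewrite cat_take_drop; apply: tequiv_trans (conjs_nf C).
exact: conjs_perm.
Qed.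

(** * Typing *)

Lemma typing_var_inv x A : has_type (Var x) A -> tequiv A (fst x).
Proof.
move E: (Var x) => r H; elim: H E => // {r A}.
- by move=> y A H [->].
- move=> r A B _ IH E Er; apply: tequiv_trans (tequiv_sym _ _ E) _.
  exact: IH.
Qed.

Lemma typing_lam_inv x r C : has_type (Lam x r) C ->
  exists2 B, has_type r B & tequiv (Arr (fst x) B) C.
Proof.
move E: (Lam x r) => t H; elim: H E => // {t C}.
- by move=> t A B _ IH E /IH [D HD ED]; exists D => //; apply: tequiv_trans E.
- move=> y t A B Hy Ht _ [-> ->]; exists B => //.
  by apply: tequiv_arr; [apply: tequiv_sym | apply: tequiv_refl].
Qed.

(** No equivalence on [C] remains: conversions of the result are absorbed into the codomain of
    [r]. *)
Lemma typing_app_inv r s C : has_type (App r s) C ->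
  exists2 A, has_type r (Arr A C) & has_type s A.
Proof.
move E: (App r s) => t H; elim: H E => // {t C}.
- move=> t A B _ IH E /IH [D Hr Hs]; exists D => //.
  by apply: ht_equiv Hr _; apply: tequiv_arr E; apply: tequiv_refl.
- by move=> r' s' A B Hr _ Hs _ [-> ->]; exists A.
Qed.

Lemma typing_prod_inv r s C : has_type (Prod r s) C ->
  exists A B, [/\ has_type r A, has_type s B & tequiv (Conj A B) C].
Proof.
move E: (Prod r s) => t H; elim: H E => // {t C}.
- move=> t A B _ IH E /IH [D [D' [Hr Hs ED]]]; exists D, D'; split=> //.
  exact: tequiv_trans E.
- move=> r' s' A B Hr _ Hs _ [-> ->]; exists A, B; split=> //.
  exact: tequiv_refl.
Qed.

Lemma typing_proj_inv A r C : has_type (Proj A r) C ->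
  tequiv A C /\ exists B, has_type r (Conj A B).
Proof.
move E: (Proj A r) => t H; elim: H E => // {t C}.
- by move=> t B C _ IH E /IH [EB HB]; split=> //; apply: tequiv_trans E.
- by move=> r' A' B Hr _ [-> ->]; split; [apply: tequiv_refl | exists B].
Qed.

(** Variables carry their types, so no context is involved. In an application the induction
    hypothesis for the argument identifies the domains, and then the codomains agree by
    [tequiv_arr_inj]. *)
Lemma typing_unique r A B : has_type r A -> has_type r B -> tequiv A B.
Proof.
elim: r A B => [x|x r IH|r IHr s IHs|r IHr s IHs|D r _] A B.
- move=> /typing_var_inv EA /typing_var_inv EB.
  exact: tequiv_trans EA (tequiv_sym _ _ EB).
- move=> /typing_lam_inv [A' HA EA] /typing_lam_inv [B' HB EB].
  apply: tequiv_trans (tequiv_sym _ _ EA) _; apply: tequiv_trans EB.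
  by apply: tequiv_arr; [apply: tequiv_refl | apply: IH].
- move=> /typing_app_inv [A' HA sA] /typing_app_inv [B' HB sB].
  by apply: (@tequiv_arr_inj A' B'); [apply: IHs | apply: IHr].
- move=> /typing_prod_inv [A1 [A2 [H1 H2 EA]]].
  move=> /typing_prod_inv [B1 [B2 [H1' H2' EB]]].
  apply: tequiv_trans (tequiv_sym _ _ EA) _; apply: tequiv_trans EB.
  by apply: tequiv_conj; [apply: IHr | apply: IHs].
- move=> /typing_proj_inv [EA _] /typing_proj_inv [EB _].
  exact: tequiv_trans (tequiv_sym _ _ EA) EB.
Qed.

(** * Typing and substitution *)

Definition well_typed_subst (sigma : var -> preterm) : Prop :=
  forall y, has_type (sigma y) (fst y).

Lemma well_typed_Var : well_typed_subst Var.
Proof. by move=> y; apply/ht_var/tequiv_refl. Qed.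

Lemma well_typed_update sigma x s :
  well_typed_subst sigma -> has_type s (fst x) ->
  well_typed_subst (update sigma x s).
Proof. by move=> Hsigma Hs y; rewrite /update; case: var_eq_dec => [->|_]. Qed.

Lemma fst_refresh x l : fst (refresh x l) = fst x.
Proof. by rewrite /refresh; case: List.in_dec. Qed.

(** Quantifying over [sigma] lets the induction pass under binders, where refreshing keeps the type
    of the bound variable. Recovering the type of a variable from that of its image uses
    [typing_unique]. *)
Lemma typing_msubst sigma r A :
  well_typed_subst sigma -> has_type (msubst sigma r) A <-> has_type r A.
Proof.
elim: r sigma A => [x|x r IH|r IHr s IHs|r IHr s IHs|B r IH] sigma A Hsigma /=.
- split=> [H|/typing_var_inv E].
    by apply: ht_var; apply: typing_unique H (Hsigma x).
  exact: ht_equiv (Hsigma x) (tequiv_sym _ _ E).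
- set z := refresh _ _; have Ez : fst z = fst x by apply: fst_refresh.
  have Hup : well_typed_subst (update sigma x (Var z)).
    by apply: well_typed_update => //; rewrite -Ez; apply: well_typed_Var.
  split=> /typing_lam_inv [B HB EB]; apply: ht_equiv EB.
    by apply: ht_lam; [rewrite Ez; apply: tequiv_refl | apply/(IH _ _ Hup)].
  by apply: ht_lam; [rewrite -Ez; apply: tequiv_refl | apply/(IH _ _ Hup)].
- split=> /typing_app_inv [B HB HB'].
    by apply: (ht_app _ _ B); [apply/(IHr sigma) | apply/(IHs sigma)].
  by apply: (ht_app _ _ B); [apply/(IHr sigma) | apply/(IHs sigma)].
- split=> /typing_prod_inv [B1 [B2 [H1 H2 E]]]; apply: ht_equiv E.
    by apply: ht_prod; [apply/(IHr sigma) | apply/(IHs sigma)].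
  by apply: ht_prod; [apply/(IHr sigma) | apply/(IHs sigma)].
- split=> /typing_proj_inv [E [C HC]]; apply: ht_equiv E.
    by apply: (ht_proj _ _ C); apply/(IH sigma).
  by apply: (ht_proj _ _ C); apply/(IH sigma).
Qed.

Lemma typing_subst s x r A :
  has_type s (fst x) -> has_type (subst s x r) A <-> has_type r A.
Proof. by move=> Hs; apply/typing_msubst/well_typed_update/Hs/well_typed_Var. Qed.

(** * Invariance under [alpha] and [teq] *)

(** An equivalence, so that the symmetry rules of [alpha] and [teq] go through by induction. *)
Definition same_types (r s : preterm) : Prop :=
  forall A, has_type r A <-> has_type s A.

Definition preserves_types (r s : preterm) : Prop :=
  forall A, has_type r A -> has_type s A.

(** The binders may differ, as renaming requires. *)
Lemma preserves_lam x y r s : tequiv (fst x) (fst y) ->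
  preserves_types r s -> preserves_types (Lam x r) (Lam y s).
Proof.
move=> E H A /typing_lam_inv [B HB EB]; apply: ht_equiv EB.
by apply: ht_lam; [| apply: H].
Qed.

Lemma preserves_app r r' s s' : preserves_types r r' -> preserves_types s s' ->
  preserves_types (App r s) (App r' s').
Proof.
move=> Hr Hs A /typing_app_inv [B HB HB'].
by apply: (ht_app _ _ B); [apply: Hr | apply: Hs].
Qed.

Lemma preserves_prod r r' s s' : preserves_types r r' -> preserves_types s s' ->
  preserves_types (Prod r s) (Prod r' s').
Proof.
move=> Hr Hs A /typing_prod_inv [B1 [B2 [H1 H2 E]]]; apply: ht_equiv E.
by apply: ht_prod; [apply: Hr | apply: Hs].
Qed.

Lemma preserves_proj B r s : preserves_types r s ->
  preserves_types (Proj B r) (Proj B s).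
Proof.
move=> H A /typing_proj_inv [E [C HC]]; apply: ht_equiv E.
by apply: (ht_proj _ _ C); apply: H.
Qed.

Lemma preserves_refl r : preserves_types r r.
Proof. by []. Qed.
#[local] Hint Resolve preserves_refl tequiv_refl : core.

Lemma same_typesP r s :
  same_types r s <-> preserves_types r s /\ preserves_types s r.
Proof.
split=> [H|[H H'] A]; first by split=> A /H.
by split; [apply: H | apply: H'].
Qed.

Lemma alpha_same_types r s : alpha r s -> same_types r s.
Proof.
elim=> {r s}.
- by [].
- by move=> r s _ IH A; rewrite IH.
- by move=> r s t _ IH1 _ IH2 A; rewrite IH1.
- move=> x r s _ /same_typesP[H H']; apply/same_typesP.
  by split; apply: preserves_lam.
- move=> r r' s s' _ /same_typesP[H1 H1'] _ /same_typesP[H2 H2'].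
  by apply/same_typesP; split; apply: preserves_app.
- move=> r r' s s' _ /same_typesP[H1 H1'] _ /same_typesP[H2 H2'].
  by apply/same_typesP; split; apply: preserves_prod.
- move=> A r s _ /same_typesP[H H']; apply/same_typesP.
  by split; apply: preserves_proj.
- move=> A x y r Ex Ey _.
  have Exy : tequiv (fst x) (fst y) := tequiv_trans _ _ _ (tequiv_sym _ _ Ex) Ey.
  have Hy : has_type (Var y) (fst x) by apply: ht_var.
  apply/same_typesP; split; apply: preserves_lam => //; try exact: tequiv_sym.
    by move=> B H; apply/(typing_subst _ _ Hy).
  by move=> B /(typing_subst _ _ Hy).
Qed.

Lemma teq_same_types r s : teq r s -> same_types r s.
Proof.
elim=> {r s}.
- have H r s : preserves_types (Prod r s) (Prod s r).
    move=> A /typing_prod_inv [B1 [B2 [H1 H2 E]]].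
    by apply: ht_equiv (ht_prod _ _ _ _ H2 H1) (tequiv_trans _ _ _ (tequiv_comm _ _) E).
  by move=> r s; apply/same_typesP.
- move=> r s t A; split.
    move=> /typing_prod_inv [B [D [/typing_prod_inv [B1 [B2 [H1 H2 EB]]] H E]]].
    apply: ht_equiv (ht_prod _ _ _ _ H1 (ht_prod _ _ _ _ H2 H)) _.
    apply: tequiv_trans (tequiv_assoc _ _ _) _; apply: tequiv_trans E.
    exact: tequiv_conj.
  move=> /typing_prod_inv [D [B [H /typing_prod_inv [B1 [B2 [H1 H2 EB]]] E]]].
  apply: ht_equiv (ht_prod _ _ _ _ (ht_prod _ _ _ _ H H1) H2) _.
  apply: tequiv_trans (tequiv_sym _ _ (tequiv_assoc _ _ _)) _.
  by apply: tequiv_trans E; apply: tequiv_conj.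
- move=> x r s A; have Hx : inV (fst x) x by apply: tequiv_refl.
  split.
    move=> /typing_lam_inv [B /typing_prod_inv [B1 [B2 [H1 H2 EB]]] E].
    apply: ht_equiv (ht_prod _ _ _ _ (ht_lam _ _ _ _ Hx H1) (ht_lam _ _ _ _ Hx H2)) _.
    apply: tequiv_trans (tequiv_sym _ _ (tequiv_dist _ _ _)) _.
    by apply: tequiv_trans E; apply: tequiv_arr.
  move=> /typing_prod_inv [D1 [D2]].
  move=> [/typing_lam_inv [B1 H1 E1] /typing_lam_inv [B2 H2 E2] E].
  apply: ht_equiv (ht_lam _ _ _ _ Hx (ht_prod _ _ _ _ H1 H2)) _.
  apply: tequiv_trans (tequiv_dist _ _ _) _.
  by apply: tequiv_trans E; apply: tequiv_conj.
- move=> r s t A; split.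
    move=> /typing_app_inv [B /typing_app_inv [D Hr Hs] Ht].
    apply: ht_app (ht_prod _ _ _ _ Hs Ht); apply: ht_equiv Hr _.
    exact/tequiv_sym/tequiv_curry.
  move=> /typing_app_inv [B Hr /typing_prod_inv [B1 [B2 [H1 H2 E]]]].
  apply: (ht_app _ _ _ _ (ht_app _ _ _ _ _ H1) H2); apply: ht_equiv Hr _.
  apply: tequiv_trans (tequiv_curry _ _ _); apply: tequiv_arr => //.
  exact: tequiv_sym.
- by move=> r s _ IH A; rewrite IH.
- move=> x r s _ /same_typesP[H H']; apply/same_typesP.
  by split; apply: preserves_lam.
- move=> r s t _ /same_typesP[H H']; apply/same_typesP.
  by split; apply: preserves_app.
- move=> r s t _ /same_typesP[H H']; apply/same_typesP.
  by split; apply: preserves_app.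
- move=> r s t _ /same_typesP[H H']; apply/same_typesP.
  by split; apply: preserves_prod.
- move=> r s t _ /same_typesP[H H']; apply/same_typesP.
  by split; apply: preserves_prod.
- move=> A r s _ /same_typesP[H H']; apply/same_typesP.
  by split; apply: preserves_proj.
- move=> r r' s s' /alpha_same_types H1 _ H2 /alpha_same_types H3 A.
  by rewrite H1 H2.
Qed.

(** * Preservation under reduction *)

Lemma red_bpz_preserves r s : red_bpz r s -> preserves_types r s.
Proof.
case=> {r s}.
- move=> A x r s Hx Hs C /typing_app_inv [A' /typing_lam_inv [B HB E] Hs'].
  (* Uniqueness for the argument [s] matches the domain used by the application with the type of the
     bound variable, so the codomains can be compared. *)
  have EA : tequiv A' (fst x) := tequiv_trans _ _ _ (typing_unique Hs' Hs) Hx.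
  have EB := tequiv_arr_inj (tequiv_sym _ _ EA) E.
  by apply/typing_subst; [apply: ht_equiv Hs Hx | apply: ht_equiv HB EB].
- by move=> A r s Hr C /typing_proj_inv [E _]; apply: ht_equiv Hr E.
- move=> r s t C /typing_app_inv [A /typing_prod_inv [B1 [B2 [H1 H2]]]].
  (* The type of the product is only equivalent to an arrow; splitting it makes each factor a
     function on [A]. *)
  move=> /tequiv_conj_arr [C1 [C2 [E1 E2 E]]] Ht; apply: ht_equiv E.
  by apply: ht_prod; apply: ht_app Ht; [apply: ht_equiv H1 E1 | apply: ht_equiv H2 E2].
Qed.

(** The rules expand [r] at one particular type; uniqueness carries the result over to any other
    type of [r]. *)
Lemma red_ed_preserves r s : red_ed r s -> preserves_types r s.
Proof.
case=> {r s}.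
- move=> A B x r Hr _ Hx _ C /(typing_unique Hr) E; apply: ht_equiv E.
  by apply: (ht_lam _ _ _ _ Hx); apply: ht_app Hr (ht_var _ _ Hx).
- move=> A B r Hr _ C /(typing_unique Hr) E; apply: ht_equiv E.
  apply: ht_prod; first exact: ht_proj Hr.
  (* [ht_proj] extracts the left conjunct, so the conjunction is commuted first. *)
  by apply: (ht_proj _ _ A); apply: ht_equiv Hr (tequiv_comm _ _).
Qed.

Scheme hred_red_ind := Minimality for hred Sort Prop
  with red_hred_ind := Minimality for red Sort Prop.

(** The hook only restricts the contexts in which expansion may occur, while every context preserves
    types; hence one predicate serves both relations. *)
Lemma red_preserves r s : red r s -> preserves_types r s.
Proof.
have Halpha t t' u u' : alpha t t' -> preserves_types t' u' -> alpha u' u ->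
    preserves_types t u.
  by move=> /alpha_same_types H1 H2 /alpha_same_types H3 A /H1 /H2 /H3.
move: r s; apply: (red_hred_ind
  (P := preserves_types) (P0 := preserves_types)).
- exact: red_bpz_preserves.
- by move=> *; apply: preserves_lam.
- by move=> *; apply: preserves_app.
- by move=> *; apply: preserves_app.
- by move=> *; apply: preserves_prod.
- by move=> *; apply: preserves_prod.
- by move=> *; apply: preserves_proj.
- by move=> t t' u u' Ht _; apply: Halpha Ht.
- exact: red_ed_preserves.
- by [].
- by move=> t t' u u' Ht _; apply: Halpha Ht.
Qed.

Theorem mainTheorem1 (r s : preterm) (A : type) :
  has_type r A -> red r s \/ teq r s -> has_type s A.
Proof.
by move=> HA [/red_preserves H | /teq_same_types H]; apply/H.
Qed.
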